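(* Let $\mathcal M$ be a space of $\mathcal Y$-valued functions contained isometrically in the Arveson space $\mathcal H_{\mathcal Y}(k_d)$ (i.e. $\mathcal M\subseteq\mathcal H_{\mathcal Y}(k_d)$ is a Hilbert space in the norm of $\mathcal H_{\mathcal Y}(k_d)$), and let $T_1,\dots,T_d\in\mathcal L(\mathcal M)$ satisfy, for every $f\in\mathcal M$, $$f(\boldsymbol\lambda)-f(0)=\sum_{j=1}^d\lambda_j(T_jf)(\boldsymbol\lambda)\ \ (\boldsymbol\lambda\in\mathbb B^d)\quad\text{and}\quad\sum_{j=1}^d\|T_jf\|^2\le\|f\|^2-\|f(0)\|^2_{\mathcal Y}.$$ Then $\mathcal M$ is invariant under $M^*_{\lambda_1},\dots,M^*_{\lambda_d}$ and $T_j=M^*_{\lambda_j}|_{\mathcal M}$ for $j=1,\dots,d$.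
   Context: $\mathbb B^d$: open unit ball of $\mathbb C^d$. For $\mathbf n\in\mathbb Z^d_+$: $|\mathbf n|=\sum n_k$, $\mathbf n!=\prod n_k!$, $\boldsymbol\lambda^{\mathbf n}=\prod\lambda_k^{n_k}$. The Arveson space $\mathcal H_{\mathcal Y}(k_d)$ is the Hilbert space of functions $f(\boldsymbol\lambda)=\sum_{\mathbf n}f_{\mathbf n}\boldsymbol\lambda^{\mathbf n}$ on $\mathbb B^d$, $f_{\mathbf n}\in\mathcal Y$, with $\|f\|^2=\sum_{\mathbf n}\frac{\mathbf n!}{|\mathbf n|!}\|f_{\mathbf n}\|^2<\infty$ (reproducing kernel $(1-\langle\boldsymbol\lambda,\boldsymbol\zeta\rangle)^{-1}$). $M_{\lambda_j}$ is multiplication by $\lambda_j$ on $\mathcal H_{\mathcal Y}(k_d)$ and $M^*_{\lambda_j}$ its adjoint. *)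

(* Defs.v *)
(* MathComp + MathComp-Analysis, complex numbers from mathcomp-real-closed *)
From HB Require Import structures.
From mathcomp Require Import all_boot all_order all_algebra.
From mathcomp Require Import all_classical all_reals all_analysis.
From mathcomp Require Import complex.
Set Implicit Arguments. Unset Strict Implicit. Unset Printing Implicit Defensive.
Import Order.TTheory GRing.Theory Num.Theory.
Import numFieldTopology.Exports numFieldNormedType.Exports.
Local Open Scope ring_scope.
Local Open Scope classical_set_scope.

Section Arveson.
Variables (R : realType) (d : nat).
Notation C := (R[i]).

(* Y: a complex inner product space, with inner product [ip] *)
Variable (Y : lmodType C) (ip : Y -> Y -> C).

(* squared norm of Y *)
Definition ynorm2 (y : Y) : R := complex.Re (ip y y).

Definition ycvg (u : nat -> Y) (l : Y) : Prop :=
  (fun k => ynorm2 (u k - l)) @ \oo --> (0 : R).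

(* [ip] makes Y a (complete) Hilbert space *)
Definition is_hilbert : Prop :=
  [/\ (forall (a : C) (x y z : Y), ip (a *: x + y) z = a * ip x z + ip y z),
      (forall x y : Y, ip x y = (ip y x)^*),
      (forall x : Y, 0 <= ip x x),
      (forall x : Y, ip x x = 0 -> x = 0) &
      (forall u : nat -> Y,
         (forall e : R, 0 < e -> exists N, forall m n, (N <= m)%N -> (N <= n)%N ->
            ynorm2 (u m - u n) < e) ->
         exists l, ycvg u l)].

(* multi-indices n in Z_+^d *)
Definition mi := {ffun 'I_d -> nat}.
Definition mdeg (n : mi) : nat := (\sum_i n i)%N.
Definition mfact (n : mi) : nat := (\prod_i (n i)`!)%N.
(* the weight n!/|n|! *)
Definition weight (n : mi) : R := (mfact n)%:R / ((mdeg n)`!)%:R.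
Definition weightC (n : mi) : C := (mfact n)%:R / ((mdeg n)`!)%:R.

(* a Y-valued power series f(lam) = sum_n f_n lam^n, given by its coefficients *)
Definition coefs := mi -> Y.

Definition czero : coefs := fun _ => 0.
Definition cadd (f g : coefs) : coefs := fun n => f n + g n.
Definition cscale (a : C) (f : coefs) : coefs := fun n => a *: f n.
Definition copp (f : coefs) : coefs := fun n => - f n.

(* sum of F over multi-indices of total degree k (a finite set) *)
Definition deg_sum (V : zmodType) (k : nat) (F : mi -> V) : V :=
  \sum_(m : {ffun 'I_d -> 'I_k.+1} | (\sum_i (m i : nat) == k)%N)
     F [ffun i => (m i : nat)].

(* squared norm of the Arveson space H_Y(k_d) *)
Definition Hnorm2 (f : coefs) : \bar R :=
  \esum_(n in [set: mi]) ((weight n * ynorm2 (f n))%:E).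

Definition inH (f : coefs) : Prop := (Hnorm2 f < +oo)%E.

(* inner product of H_Y(k_d): sum_n (n!/|n|!) <f_n, g_n>_Y (summed by degree) *)
Definition Hip_term (f g : coefs) (k : nat) : C :=
  deg_sum k (fun n => weightC n * ip (f n) (g n)).
Definition Hip (f g : coefs) : C :=
  Complex (limn (series (fun k => complex.Re (Hip_term f g k))))
  (limn (series (fun k => complex.Im (Hip_term f g k)))).

(* the open unit ball B^d *)
Definition ball_d (lam : 'I_d -> C) : Prop := \sum_i `|lam i| ^+ 2 < 1.
Definition mpow (lam : 'I_d -> C) (n : mi) : C := \prod_i lam i ^+ n i.
Definition origin : 'I_d -> C := fun _ => 0.

(* point evaluation f(lam) = sum_n f_n lam^n *)
Definition ev (f : coefs) (lam : 'I_d -> C) : Y :=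
  xget 0 (fun l => ycvg (fun K => \sum_(k < K) deg_sum k (fun n => mpow lam n *: f n)) l).

(* M_{lambda_j}: multiplication by lambda_j, on coefficients *)
Definition Mmul (j : 'I_d) (g : coefs) : coefs :=
  fun n => if (0 < n j)%N then g [ffun i => if i == j then (n i).-1 else n i] else 0.

(* the adjoint M*_{lambda_j} on H_Y(k_d) *)
Definition Madj (j : 'I_d) (f : coefs) : coefs :=
  xget czero (fun h => inH h /\ forall g, inH g -> Hip (Mmul j g) f = Hip g h).

(* M is a linear subspace of H_Y(k_d), complete in the norm of H_Y(k_d) *)
Definition isometric_subspace (M : set coefs) : Prop :=
  [/\ M `<=` inH, M czero,
      (forall a f g, M f -> M g -> M (cadd (cscale a f) g)) &
      (forall u : nat -> coefs, (forall k, M (u k)) ->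
         (forall e : R, 0 < e -> exists N, forall m n, (N <= m)%N -> (N <= n)%N ->
            (Hnorm2 (cadd (u m) (copp (u n))) < e%:E)%E) ->
         exists2 f, M f & (fun k => fine (Hnorm2 (cadd (u k) (copp f)))) @ \oo --> (0 : R))].

(* T is a bounded linear operator on M *)
Definition bounded_op_on (M : set coefs) (T : coefs -> coefs) : Prop :=
  [/\ forall f, M f -> M (T f),
      (forall a f g, M f -> M g -> T (cadd (cscale a f) g) = cadd (cscale a (T f)) (T g)) &
      exists K : R, forall f, M f -> (Hnorm2 (T f) <= K%:E * Hnorm2 f)%E].

End Arveson.

(* Main.v *)
Require Import Defs.
From HB Require Import structures.
From mathcomp Require Import all_boot all_order all_algebra.
From mathcomp Require Import all_classical all_reals all_analysis.
From mathcomp Require Import complex.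
From mathcomp Require Import ring lra.
Import Order.TTheory GRing.Theory Num.Theory.
Import numFieldTopology.Exports numFieldNormedType.Exports.
Set Implicit Arguments. Unset Strict Implicit. Unset Printing Implicit Defensive.
Local Open Scope ring_scope.
Local Open Scope classical_set_scope.

(* Power series are determined by their values near the origin, so the first
   hypothesis says that [f_n] is the sum over [j] with [n_j > 0] of the
   [(n - e_j)]-th coefficients of the [T_j f], for every [n <> 0]. With the
   weights [w(n) = n!/|n|!], which satisfy [w(n - e_j) n_j / |n| = w(n)],
   expanding the squares gives
     sum_j w(n - e_j) |(T_j f)_(n - e_j) - (n_j/|n|) f_n|^2
       = sum_j w(n - e_j) |(T_j f)_(n - e_j)|^2 - w(n) |f_n|^2.
   Summed over [n <> 0], the right-hand side is at most 0 by the second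
   hypothesis, hence [(T_j f)_(n - e_j) = (n_j/|n|) f_n] for all [n] and [j].
   These are the coefficients of the adjoint of multiplication by [lambda_j]. *)

(** * Norm, Cauchy-Schwarz inequality and limits in the Hilbert space [Y] *)

Section HilbertNorm.
Variables (R : realType) (Y : lmodType R[i]) (ip : Y -> Y -> R[i]).
Hypothesis hilb : is_hilbert ip.
Notation q := (ynorm2 ip).

Let ipDl x y z : ip (x + y) z = ip x z + ip y z.
Proof. by case: hilb => h _ _ _ _; rewrite -{1}(scale1r x) h mul1r. Qed.

Lemma ip0l z : ip 0 z = 0.
Proof. by apply: (addIr (ip 0 z)); rewrite -ipDl !add0r. Qed.

Lemma ipZl a x z : ip (a *: x) z = a * ip x z.
Proof. by case: hilb => h _ _ _ _; rewrite -[a *: x]addr0 h ip0l addr0. Qed.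

Let ipC x y : ip x y = (ip y x)^*%R. Proof. by case: hilb. Qed.

Lemma ipZr a x z : ip x (a *: z) = a^*%R * ip x z.
Proof. by rewrite (ipC x z) ipC ipZl rmorphM. Qed.

Lemma ipBr x y z : ip x (y - z) = ip x y - ip x z.
Proof.
by rewrite (ipC x y) (ipC x z) ipC -scaleN1r ipDl ipZl mulN1r rmorphB.
Qed.

Lemma ip_definite x : ip x x = 0 -> x = 0.
Proof. by case: hilb => _ _ _ h _; exact: h. Qed.

(** The underlying real inner product: the scalars in the norm estimates below are all real. *)
Definition rip x y : R := complex.Re (ip x y).

Lemma ripC x y : rip x y = rip y x.
Proof. by rewrite /rip ipC; case: (ip y x) => u v; cbn. Qed.

Lemma ripDl x y z : rip (x + y) z = rip x z + rip y z.
Proof. by rewrite /rip ipDl; case: (ip x z); case: (ip y z). Qed.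

Lemma ripZl (a : R) x z : rip (a%:C%C *: x) z = a * rip x z.
Proof. by rewrite /rip ipZl; case: (ip x z) => u v /=; rewrite mul0r subr0. Qed.

Lemma rip_suml (I : Type) (r : seq I) (P : pred I) (F : I -> Y) z :
  rip (\sum_(i <- r | P i) F i) z = \sum_(i <- r | P i) rip (F i) z.
Proof.
elim/big_rec2: _ => [|i u v _ <-]; last by rewrite ripDl.
by rewrite /rip ip0l.
Qed.

Lemma ynorm2E x : q x = rip x x. Proof. by []. Qed.

Lemma ynorm2_ge0 x : 0 <= q x.
Proof.
case: hilb => _ _ h _ _; have := h x; rewrite /ynorm2.
by case: (ip x x) => u v; rewrite lecE => /andP[].
Qed.

Lemma ynorm2_eq0 x : q x = 0 -> x = 0.
Proof.
move=> h; apply: ip_definite; move: h; case: hilb => _ _ h _ _; have := h x.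
by rewrite /ynorm2; case: (ip x x) => u v; rewrite lecE /= => /andP[/eqP-> _] ->.
Qed.

Lemma ynorm20 : q 0 = 0. Proof. by rewrite /ynorm2 ip0l. Qed.

Lemma ynorm2D x y : q (x + y) = q x + 2 * rip x y + q y.
Proof.
rewrite !ynorm2E ripDl (ripC x (x + y)) (ripC y (x + y)) !ripDl (ripC y x).
ring.
Qed.

Lemma ynorm2Z (a : R) x : q (a%:C%C *: x) = a ^+ 2 * q x.
Proof. by rewrite !ynorm2E ripZl ripC ripZl mulrA. Qed.

Lemma ynorm2_lin x y (a : R) :
  q (x - a%:C%C *: y) = q x - 2 * a * rip x y + a ^+ 2 * q y.
Proof.
rewrite -scaleNr -rmorphN ynorm2D ynorm2Z ripC ripZl ripC; ring.
Qed.

Lemma rip_CS x y : rip x y ^+ 2 <= q x * q y.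
Proof.
have [/eqP/ynorm2_eq0 ->|qy] := boolP (q y == 0).
  by rewrite ripC /rip ip0l /= expr0n /= mulr_ge0 ?ynorm2_ge0.
have qy0 : 0 < q y by rewrite lt_def qy ynorm2_ge0.
(* The coefficient of y is the real t that minimises |x - t y|^2. *)
have := ynorm2_ge0 (x - (rip x y / q y)%:C%C *: y); rewrite ynorm2_lin.
have -> : q x - 2 * (rip x y / q y) * rip x y + (rip x y / q y) ^+ 2 * q y
  = (q x * q y - rip x y ^+ 2) / q y by field.
by rewrite pmulr_lge0 ?invr_gt0// subr_ge0.
Qed.

Definition ynorm y : R := Num.sqrt (q y).

Lemma ynorm_ge0 x : 0 <= ynorm x. Proof. exact: sqrtr_ge0. Qed.

Lemma sqr_ynorm x : ynorm x ^+ 2 = q x.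
Proof. by rewrite sqr_sqrtr// ynorm2_ge0. Qed.

Lemma ynorm0 : ynorm 0 = 0. Proof. by rewrite /ynorm ynorm20 sqrtr0. Qed.

Lemma ynorm_eq0 x : ynorm x = 0 -> x = 0.
Proof. by move=> h; apply: ynorm2_eq0; rewrite -sqr_ynorm h expr0n. Qed.

Lemma ynormD x y : ynorm (x + y) <= ynorm x + ynorm y.
Proof.
rewrite -(ler_pXn2r (ltn0Sn 1)) ?nnegrE ?addr_ge0 ?ynorm_ge0//.
rewrite sqr_ynorm ynorm2D sqrrD !sqr_ynorm lerD2r lerD2l mulr_natl ler_pMn2r//.
apply: le_trans (ler_norm _) _.
rewrite -(ler_pXn2r (ltn0Sn 1)) ?nnegrE ?mulr_ge0 ?ynorm_ge0//.
by rewrite real_normK ?num_real// exprMn !sqr_ynorm rip_CS.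
Qed.

Lemma ynormZ (a : R) x : ynorm (a%:C%C *: x) = `|a| * ynorm x.
Proof. by rewrite /ynorm ynorm2Z sqrtrM ?sqr_ge0// sqrtr_sqr. Qed.

Lemma ynormN x : ynorm (- x) = ynorm x.
Proof. by rewrite -scaleN1r -(rmorph1 (real_complex R)) -rmorphN ynormZ normrN1 mul1r. Qed.

Lemma ynorm_sum (I : Type) (r : seq I) (P : pred I) (F : I -> Y) :
  ynorm (\sum_(i <- r | P i) F i) <= \sum_(i <- r | P i) ynorm (F i).
Proof.
elim/big_rec2: _ => [|i u v _ h]; first by rewrite ynorm0.
by apply: le_trans (ynormD _ _) _; rewrite lerD2l.
Qed.

(** [ycvg] is defined with squared norms, whereas the limit rules below rest on the triangle
    inequality for [ynorm]. *)
Lemma ycvgP (u : nat -> Y) l :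
  ycvg ip u l <-> (fun k => ynorm (u k - l)) @ \oo --> (0 : R).
Proof.
split=> h.
  rewrite -(@sqrtr0 R).
  exact: (@continuous_cvg _ _ _ _ _ _ (@Num.sqrt R) _ (@sqrt_continuous R 0) h).
rewrite /ycvg; have -> : (fun k => q (u k - l)) =
   (fun k => ynorm (u k - l) * ynorm (u k - l)).
  by apply/funext => k; rewrite -sqr_ynorm.
by rewrite -(mulr0 0); apply: cvgM.
Qed.

Lemma ycvg_squeeze (u : nat -> Y) l (b : nat -> R) :
  (forall k, ynorm (u k - l) <= b k) -> b @ \oo --> (0 : R) -> ycvg ip u l.
Proof.
move=> h hb; apply/ycvgP; apply: (@squeeze_cvgr _ _ _ _ (cst 0) b) => //.
  by apply: nearW => k; rewrite ynorm_ge0 h.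
exact: cvg_cst.
Qed.

Lemma ycvgD u v l m : ycvg ip u l -> ycvg ip v m ->
  ycvg ip (fun k => u k + v k) (l + m).
Proof.
move=> /ycvgP hu /ycvgP hv.
apply: (@ycvg_squeeze _ _ (fun k => ynorm (u k - l) + ynorm (v k - m))).
  by move=> k; rewrite opprD addrACA; exact: ynormD.
by rewrite -(addr0 0); apply: cvgD.
Qed.

Lemma ycvgZ (a : R) u l : ycvg ip u l ->
  ycvg ip (fun k => a%:C%C *: u k) (a%:C%C *: l).
Proof.
move=> /ycvgP hu.
apply: (@ycvg_squeeze _ _ (fun k => `|a| * ynorm (u k - l))).
  by move=> k; rewrite -scalerBr ynormZ.
rewrite -(mulr0 `|a|); apply: cvgM => //; exact: cvg_cst.
Qed.

Lemma ycvg_cst l : ycvg ip (fun=> l) l.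
Proof.
apply: (@ycvg_squeeze _ _ (cst 0)); last exact: cvg_cst.
by move=> k; rewrite subrr ynorm0.
Qed.

Lemma ycvg_sum (I : Type) (r : seq I) (u : I -> nat -> Y) (l : I -> Y) :
  (forall i, ycvg ip (u i) (l i)) ->
  ycvg ip (fun k => \sum_(i <- r) u i k) (\sum_(i <- r) l i).
Proof.
move=> h; elim: r => [|i r IH].
  rewrite big_nil (_ : (fun _ => _) = fun=> 0); first exact: ycvg_cst.
  by apply/funext => k; rewrite big_nil.
rewrite big_cons (_ : (fun _ => _) = fun k => u i k + \sum_(i <- r) u i k).
  exact: ycvgD.
by apply/funext => k; rewrite big_cons.
Qed.

Lemma ycvg_shift u l : ycvg ip (fun k => u k.+1) l <-> ycvg ip u l.
Proof. by rewrite /ycvg -(cvg_shiftS (fun k => q (u k - l))). Qed.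

Lemma ycvg_near u v l : (\forall k \near \oo, u k = v k) ->
  ycvg ip u l -> ycvg ip v l.
Proof.
move=> uv; apply: cvg_trans; apply: near_eq_cvg.
by apply: filterS uv => k ->.
Qed.

Lemma ycvg_unique u l m : ycvg ip u l -> ycvg ip u m -> l = m.
Proof.
move=> hl hm; apply/eqP; rewrite -subr_eq0; apply/eqP/ynorm_eq0.
(* The sequence u - u is constantly 0 and converges to m - l. *)
have h : ycvg ip (fun=> 0) (m - l).
  have := ycvgD hm (ycvgZ (-1) hl); rewrite rmorphN rmorph1 scaleN1r.
  by congr ycvg; apply/funext => k; rewrite scaleN1r subrr.
move/ycvgP : h => /(cvg_lim (@norm_hausdorff _ R^o)).
by rewrite lim_cst// sub0r opprB.
Qed.

End HilbertNorm.

(** * Power series in one real variable with coefficients in [Y] *)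

Section PowerSeries.
Variables (R : realType) (Y : lmodType R[i]) (ip : Y -> Y -> R[i]).
Hypothesis hilb : is_hilbert ip.
Notation N := (ynorm ip).

Lemma geometric_sum_le2 (s : R) p : 0 <= s <= 2^-1 -> \sum_(0 <= i < p) s ^+ i <= 2.
Proof.
move=> /andP[s0 s1]; elim: p => [|p IH]; first by rewrite big_geq.
rewrite big_nat_recl//= expr0.
under eq_bigr do rewrite exprS.
rewrite -mulr_sumr; have := ler_wpM2l s0 IH; lra.
Qed.

Lemma geometric_tail_le (v : nat -> Y) (A s : R) n p :
  0 <= A -> 0 <= s <= 2^-1 -> (forall k, N (v k) <= A * s ^+ k) ->
  N (\sum_(n <= k < n + p) v k) <= 2 * A * s ^+ n.
Proof.
move=> A0 s01 hv; apply: (le_trans (ynorm_sum hilb _ _ _)).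
apply: (@le_trans _ _ (A * s ^+ n * \sum_(0 <= i < p) s ^+ i)).
  rewrite mulr_sumr -{1}(add0n n) big_addn addKn.
  apply: ler_sum => i _; apply: le_trans (hv _) _.
  by rewrite exprD -mulrA (mulrC (s ^+ n)).
rewrite -[leRHS]mulrA [leRHS]mulrC ler_wpM2l ?geometric_sum_le2// mulr_ge0// exprn_ge0//.
by case/andP: s01.
Qed.

Lemma ycvg_geometric (v : nat -> Y) (A : R) : 0 <= A ->
  (forall k, N (v k) <= A * 2^-1 ^+ k) ->
  exists l, ycvg ip (fun K => \sum_(k < K) v k) l.
Proof.
move=> A0 hv; case: (hilb) => _ _ _ _; apply => e e0.
have : (fun k => 2 * A * 2^-1 ^+ k) @ \oo --> (0 : R).
  rewrite -(mulr0 (2 * A)); apply: cvgM; first exact: cvg_cst.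
  by apply: cvg_expr; rewrite ger0_norm ?invr_ge0// invf_lt1// ltr1n.
(* The Cauchy condition bounds squared norms, hence the threshold [Num.sqrt e]. *)
move/cvgr0Pnorm_lt => /(_ (Num.sqrt e)); rewrite sqrtr_gt0 => /(_ e0)[n0 _ hn0].
have key m n : (n0 <= n)%N -> (n <= m)%N ->
    ynorm2 ip (\sum_(k < m) v k - \sum_(k < n) v k) < e.
  move=> nn nm; rewrite -(big_mkord xpredT v) -(big_mkord xpredT v).
  rewrite (@big_cat_nat _ _ _ n)//= addrAC subrr add0r -sqr_ynorm//.
  rewrite -(@sqr_sqrtr _ e) ?(ltW e0)// ltr_pXn2r ?nnegrE ?ynorm_ge0 ?sqrtr_ge0//.
  apply: le_lt_trans (hn0 n nn); rewrite -(subnKC nm) ger0_norm; last first.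
    by rewrite !mulr_ge0// exprn_ge0// invr_ge0.
  by apply: geometric_tail_le => //; lra.
exists n0 => m n hm hn; have [nm|mn] := leqP n m; first exact: key.
rewrite -sqr_ynorm// -ynormN// opprB sqr_ynorm//.
by apply: key => //; exact: ltnW.
Qed.

(** Strong induction on k: once the earlier coefficients vanish, s^k u_k is balanced by a tail of
    size O(s^(k+1)), since the whole series sums to 0. Dividing by s^k and letting s tend to 0 gives
    u_k = 0. *)
Lemma power_series_eq0 (u : nat -> Y) (A r : R) : 0 < r ->
  (forall k, N (u k) <= A) ->
  (forall s, 0 < s < r -> ycvg ip (fun K => \sum_(k < K) (s ^+ k)%:C%C *: u k) 0) ->
  forall k, u k = 0.
Proof.
move=> r0 hu hs; have A0 : 0 <= A by apply: le_trans (hu 0%N); exact: ynorm_ge0.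
elim/ltn_ind => k IH; apply: (@ynorm_eq0 _ _ _ hilb); apply/eqP.
rewrite eq_le ynorm_ge0 andbT.
have key s : 0 < s -> s < r -> s <= 2^-1 -> N (u k) <= 2 * A * s.
  move=> s0 sr s1; have sk : 0 < s ^+ k by rewrite exprn_gt0.
  rewrite -(ler_pM2l sk).
  have h : ycvg ip (fun K => \sum_(k < K) (s ^+ k)%:C%C *: u k) 0.
    by apply: hs; rewrite s0.
  move/(ycvgP hilb) : h => h.
  (* The terms below k vanish by induction, and the p terms after k add up to norm at most 2 A
     s^(k+1). *)
  have bound p : s ^+ k * N (u k) - s ^+ k * (2 * A * s) <=
      N (\sum_(i < k.+1 + p) (s ^+ i)%:C%C *: u i - 0).
    rewrite subr0 -(big_mkord xpredT (fun i => (s ^+ i)%:C%C *: u i)).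
    rewrite (@big_cat_nat _ _ _ k.+1) ?leq_addr//= big_nat_recr//=.
    rewrite big1_seq ?add0r; last first.
      by move=> i; rewrite mem_index_iota => /andP[_ /andP[_ ik]]; rewrite IH// scaler0.
    rewrite lerBlDr -{1}(ger0_norm (ltW sk)) -(ynormZ hilb).
    set t := \sum_(_ <= _ < _) _.
    have tail : N t <= s ^+ k * (2 * A * s).
      have -> : s ^+ k * (2 * A * s) = 2 * A * s ^+ k.+1 by rewrite exprS; ring.
      apply: geometric_tail_le => //; first by rewrite ltW.
      move=> i; rewrite ynormZ// ger0_norm ?exprn_ge0 ?(ltW s0)//.
      by rewrite mulrC ler_wpM2r// exprn_ge0 ?(ltW s0).
    rewrite -{1}[_ *: u k](addrK t); apply: le_trans (ynormD hilb _ _) _.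
    by rewrite ynormN// lerD2l.
  rewrite -subr_le0; apply: (cvgr_to_ge h); exists k.+1 => //= K kK.
  by have := bound (K - k.+1)%N; rewrite subnKC.
apply/ler_addgt0Pr => e e0; rewrite add0r.
(* The last entry makes 2 A s <= e; the summand 1 keeps its denominator positive when A = 0. *)
pose s := Num.min (r / 2) (Num.min 2^-1 (e / (2 * A + 1))).
have A1 : 0 < 2 * A + 1 by lra.
have s0 : 0 < s by rewrite !lt_min divr_gt0//= invr_gt0 ltr0n divr_gt0.
have sr : s < r by rewrite !gt_min; apply/orP; left; lra.
have s2 : s <= 2^-1 by rewrite !ge_min lexx !orbT.
have se : s <= e / (2 * A + 1) by rewrite !ge_min lexx !orbT.
apply: (le_trans (key s s0 sr s2)).
move: se; rewrite ler_pdivlMr//; nra.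
Qed.

End PowerSeries.

(** * Multi-indices, shifts by a unit vector and sums over a fixed degree *)

Section MultiIndices.
Variable d : nat.
Implicit Types (n m : mi d) (j : 'I_d).

(** The index set of [deg_sum] as a list of actual multi-indices, on which reindexing and
    permutation arguments can be run. *)
Definition mis k : seq (mi d) :=
  [seq [ffun i => (m i : nat)] | m : {ffun 'I_d -> 'I_k.+1}
     in [pred m : {ffun 'I_d -> 'I_k.+1} | \sum_i (m i : nat) == k]%N].

Lemma deg_sumE (V : zmodType) k (F : mi d -> V) :
  deg_sum k F = \sum_(n <- mis k) F n.
Proof. by rewrite /deg_sum /mis /image_mem big_map big_enum. Qed.

Lemma mis_uniq k : uniq (mis k).
Proof.
rewrite map_inj_uniq ?enum_uniq// => m1 m2 /ffunP h.
by apply/ffunP => i; apply: val_inj; have := h i; rewrite !ffunE.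
Qed.

Lemma mem_mis n k : (n \in mis k) = (mdeg n == k).
Proof.
apply/mapP/eqP => [[m]|nk].
  rewrite mem_enum inE => /eqP mk ->; rewrite -[RHS]mk /mdeg.
  by apply: eq_bigr => i _; rewrite ffunE.
have lt_n i : (n i < k.+1)%N by rewrite ltnS -nk /mdeg (bigD1 i)//= leq_addr.
exists [ffun i => Ordinal (lt_n i)].
  rewrite mem_enum inE -[X in _ == X]nk; apply/eqP/eq_bigr => i _.
  by rewrite ffunE.
by apply/ffunP => i; rewrite !ffunE.
Qed.

Lemma size_mis k : (size (mis k) <= k.+1 ^ d)%N.
Proof.
rewrite size_map -cardE; apply: leq_trans (max_card _) _.
by rewrite card_ffun !card_ord.
Qed.

Definition mi0 : mi d := [ffun=> 0%N].
(** The shifts n + e_j and n - e_j; the second leaves n unchanged when n_j = 0. *)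
Definition incr j n : mi d := [ffun i => if i == j then (n i).+1 else n i].
Definition decr j n : mi d := [ffun i => if i == j then (n i).-1 else n i].

Lemma incrK j : cancel (incr j) (decr j).
Proof. by move=> n; apply/ffunP => i; rewrite !ffunE; case: eqP. Qed.

Lemma decrK j n : (0 < n j)%N -> incr j (decr j n) = n.
Proof.
move=> nj; apply/ffunP => i; rewrite !ffunE; case: eqP => // ->.
by rewrite prednK.
Qed.

Lemma incr_gt0 j n : (0 < incr j n j)%N. Proof. by rewrite ffunE eqxx. Qed.

Lemma prod_incr (V : comNzSemiRingType) (F : 'I_d -> nat -> V) j n a :
  F j (n j).+1 = a * F j (n j) -> \prod_i F i (incr j n i) = a * \prod_i F i (n i).
Proof.
move=> h; rewrite (bigD1 j)//= [in RHS](bigD1 j)//= ffunE eqxx h mulrA.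
by congr (_ * _); apply: eq_bigr => i /negPf ij; rewrite ffunE ij.
Qed.

Lemma mdeg_incr j n : mdeg (incr j n) = (mdeg n).+1.
Proof.
rewrite /mdeg (bigD1 j)//= [in RHS](bigD1 j)//= ffunE eqxx addSn.
by congr (_ + _).+1; apply: eq_bigr => i /negPf ij; rewrite ffunE ij.
Qed.

Lemma mfact_incr j n : mfact (incr j n) = ((n j).+1 * mfact n)%N.
Proof.
rewrite /mfact (bigD1 j)//= [in RHS](bigD1 j)//= ffunE eqxx factS mulnA.
by congr (_ * _)%N; apply: eq_bigr => i /negPf ij; rewrite ffunE ij.
Qed.

Lemma mfact_gt0 n : (0 < mfact n)%N.
Proof. by rewrite prodn_gt0// => i; exact: fact_gt0. Qed.

Lemma mdeg_eq0 n : mdeg n = 0%N -> n = mi0.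
Proof.
move/eqP; rewrite sum_nat_eq0 => /forallP h; apply/ffunP => i.
by rewrite ffunE; apply/eqP; exact: h.
Qed.

Lemma mdeg0 : mdeg mi0 = 0%N.
Proof. by rewrite /mdeg big1// => i _; rewrite ffunE. Qed.

(** Induction on |n|: expand |n|! = sum_j n_j (|n| - 1)! and use n_j (n - e_j)! = n!. This bounds
    the multinomial coefficient, which is the inverse of the weight. *)
Lemma fact_mdeg_le n : ((mdeg n)`! <= d ^ mdeg n * mfact n)%N.
Proof.
move: {2}(mdeg n) (erefl (mdeg n)) => k; elim: k n => [|k IH] n nk.
  by rewrite nk mul1n mfact_gt0.
rewrite {1}nk factS -{1}nk {1}/mdeg big_distrl/=.
have : (\sum_(j < d) n j * k`! <= \sum_(j < d) d ^ k * mfact n)%N.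
  apply: leq_sum => j _; have [->//|nj] := posnP (n j).
  have e := decrK nj; have dk : mdeg (decr j n) = k.
    by move: nk; rewrite -{1}e mdeg_incr => -[].
  rewrite -[in leqRHS]e mfact_incr ffunE eqxx prednK// mulnCA leq_mul2l.
  by rewrite -{1}dk -{1}dk IH ?orbT.
by rewrite sum_nat_const card_ord nk expnS mulnA.
Qed.

Lemma deg_sum0 (V : zmodType) (F : mi d -> V) : deg_sum 0 F = F mi0.
Proof.
rewrite deg_sumE (perm_big [:: mi0]) ?big_seq1//.
apply: uniq_perm; rewrite ?mis_uniq// => n; rewrite mem_mis inE.
by apply/eqP/eqP => [/mdeg_eq0//|->]; exact: mdeg0.
Qed.

(** The map n -> n + e_j is a bijection from degree k onto the multi-indices of degree k + 1 with
    positive j-th entry. *)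
Lemma deg_sum_incr (V : zmodType) k j (F : mi d -> V) :
  (forall n, n j = 0%N -> F n = 0) ->
  deg_sum k.+1 F = deg_sum k (fun n => F (incr j n)).
Proof.
move=> F0; rewrite !deg_sumE (bigID (fun n : mi d => 0 < n j)%N)/= addrC.
rewrite big1 ?add0r; last by move=> n; rewrite -eqn0Ngt => /eqP; exact: F0.
rewrite -big_filter -(big_map (incr j) xpredT F); apply: perm_big.
apply: uniq_perm; first by rewrite filter_uniq ?mis_uniq.
  by rewrite (map_inj_uniq (can_inj (@incrK j))) mis_uniq.
move=> n; rewrite mem_filter mem_mis; apply/andP/mapP => [[nj /eqP nk]|[m]].
  exists (decr j n); last by rewrite decrK.
  by rewrite mem_mis -eqSS -nk -[in X in _ == X](decrK nj) mdeg_incr.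
by rewrite mem_mis => /eqP <- ->; rewrite incr_gt0 mdeg_incr.
Qed.

Lemma deg_sum_single (V : zmodType) (F : mi d -> V) n k :
  (forall m, m != n -> F m = 0) ->
  deg_sum k F = if k == mdeg n then F n else 0.
Proof.
move=> h; rewrite deg_sumE; case: eqP => [->|/eqP nk].
  rewrite (bigD1_seq n) ?mis_uniq ?mem_mis//= big1 ?addr0// => m; exact: h.
rewrite big1_seq// => m /andP[_]; rewrite mem_mis => /eqP mk; apply: h.
by apply: contraNneq nk => <-; rewrite mk.
Qed.

Lemma deg_sumD (V : zmodType) k (F G : mi d -> V) :
  deg_sum k (fun n => F n + G n) = deg_sum k F + deg_sum k G.
Proof. by rewrite !deg_sumE big_split. Qed.

(* Kronecker substitution: multi-indices are read as base [b] expansions, so that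
   [mu_i = s ^ (b ^ i)] turns distinct monomials into distinct powers of [s]. *)
Definition kron b n : nat := (\sum_i n i * b ^ i)%N.

(** Uniqueness of base [b] digits, by induction on their number: the digit at [ord0] is the
    remainder on division by b. *)
Lemma kron_inj b n m : (forall i, n i < b)%N -> (forall i, m i < b)%N ->
  kron b n = kron b m -> n = m.
Proof.
rewrite /kron => hn hm e; apply/ffunP.
have : forall p (u v : 'I_p -> nat), (forall i, u i < b)%N ->
    (forall i, v i < b)%N -> (\sum_i u i * b ^ i = \sum_i v i * b ^ i)%N ->
    forall i, u i = v i; last exact.
elim=> [|p IH] u v hu hv; first by move=> _ [].
have shift (w : 'I_p.+1 -> nat) : (\sum_i w i * b ^ i =
    (\sum_(i < p) w (lift ord0 i) * b ^ i) * b + w ord0)%N.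
  rewrite big_ord_recl muln1 addnC; congr addn; rewrite big_distrl/=.
  by apply: eq_bigr => i _; rewrite /bump/= add1n expnSr mulnA.
have b0 : (0 < b)%N by apply: leq_ltn_trans (hu ord0).
rewrite !shift => /(congr1 (edivn^~ b)) /=; rewrite !edivn_eq// => -[e1 e2] i.
case: (unliftP ord0 i) => [j ->|-> //].
exact: (IH (fun i => u (lift ord0 i)) _ (fun=> hu _) (fun=> hv _) e1 j).
Qed.

End MultiIndices.

(** * Growth of coefficients and uniqueness of power series in d variables *)

Lemma esum_ge_term (R : realType) (T : choiceType) (a : T -> \bar R) (t : T) :
  (forall i, 0 <= a i)%E -> (a t <= \esum_(i in [set: T]) a i)%E.
Proof.
move=> a0; apply: esum_ge; exists [set t]; last by rewrite fsbig_set1.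
by split => //; exact: finite_set1.
Qed.

Lemma leq_expl (m n e : nat) : (m <= n)%N -> (m ^ e <= n ^ e)%N.
Proof. by case: e => [|e] h; rewrite ?expn0// leq_exp2r. Qed.

Section Growth.
Variables (R : realType) (d : nat) (Y : lmodType R[i]) (ip : Y -> Y -> R[i]).
Hypothesis hilb : is_hilbert ip.
Notation N := (ynorm ip).
Implicit Types (f g : coefs d Y) (n : mi d) (mu : 'I_d -> R).

Lemma weight_gt0 n : 0 < weight R n.
Proof. by rewrite divr_gt0// ltr0n ?mfact_gt0 ?fact_gt0. Qed.

Lemma weight_incr j n :
  weight R (incr j n) = (n j).+1%:R / (mdeg n).+1%:R * weight R n.
Proof.
rewrite /weight mfact_incr mdeg_incr factS !natrM.
rewrite -mulf_div.
by congr (_ * _).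
Qed.

Lemma weight_term_ge0 f n : (0 <= (weight R n * ynorm2 ip (f n))%:E)%E.
Proof. by rewrite lee_fin mulr_ge0 ?ynorm2_ge0// ltW// weight_gt0. Qed.

Lemma Hnorm2_ge0 f : (0 <= Hnorm2 ip f)%E.
Proof. by rewrite /Hnorm2; apply: esum_ge0 => n _; exact: weight_term_ge0. Qed.

Lemma Hnorm2_fin f : inH ip f -> Hnorm2 ip f \is a fin_num.
Proof. by move=> h; rewrite ge0_fin_numE// Hnorm2_ge0. Qed.

(** Implied by finite norm, stable under sums and [Mmul], and enough for convergence near the
    origin. The base d + 1 is at least 1 even when d = 0. *)
Definition growth f := exists2 A : R, 0 <= A & forall n, N (f n) <= A * d.+1%:R ^+ mdeg n.

(** A single term of the norm is at most the whole, so |f_n|^2 <= ||f||^2 / w(n), where 1 / w(n) <=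
    (d + 1)^|n|. *)
Lemma growth_inH f : inH ip f -> growth f.
Proof.
move=> fH; pose h := fine (Hnorm2 ip f).
have h0 : 0 <= h by rewrite fine_ge0 ?Hnorm2_ge0.
(* Square roots are avoided through h <= (h + 1)^2 and D <= D^2. *)
exists (h + 1); first by rewrite addr_ge0.
move=> n; set D := _ ^+ mdeg n.
have D1 : 1 <= D by rewrite exprn_ege1// ler1n.
have D0 : 0 <= D by apply: le_trans D1.
rewrite -(ler_pXn2r (ltn0Sn 1)) ?nnegrE ?ynorm_ge0 ?mulr_ge0 ?addr_ge0//.
rewrite sqr_ynorm//.
have hw : weight R n * ynorm2 ip (f n) <= h.
  rewrite -lee_fin fineK ?Hnorm2_fin//.
  exact: (esum_ge_term n (weight_term_ge0 f)).
have Dw : 1 <= D * weight R n.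
  rewrite /weight mulrA ler_pdivlMr ?ltr0n ?fact_gt0// mul1r /D -natrX -natrM.
  rewrite ler_nat; apply: leq_trans (fact_mdeg_le n) _.
  by rewrite leq_mul2r leq_expl ?orbT.
have q0 := ynorm2_ge0 hilb (f n).
have h1 : ynorm2 ip (f n) <= D * h.
  apply: le_trans (_ : D * (weight R n * ynorm2 ip (f n)) <= _).
    by rewrite mulrA ler_peMl.
  by rewrite ler_wpM2l.
apply: le_trans h1 _; rewrite exprMn mulrC; apply: ler_pM => //; first nra.
by rewrite expr2 ler_peMl.
Qed.

Lemma growthD f g : growth f -> growth g -> growth (fun n => f n + g n).
Proof.
move=> [A A0 hA] [B B0 hB]; exists (A + B); first exact: addr_ge0.
by move=> n; apply: le_trans (ynormD hilb _ _) _; rewrite mulrDl lerD.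
Qed.

Lemma growthN f : growth f -> growth (fun n => - f n).
Proof. by move=> [A A0 hA]; exists A => // n; rewrite ynormN. Qed.

Lemma growth_Mmul j f : growth f -> growth (Mmul j f).
Proof.
move=> [A A0 hA]; exists A => // n; rewrite /Mmul; case: ifP => nj.
  apply: le_trans (hA _) _; rewrite ler_wpM2l// -[in leRHS](decrK nj) mdeg_incr.
  by rewrite exprS ler_peMl ?exprn_ge0// ler1n.
by rewrite ynorm0// mulr_ge0// exprn_ge0.
Qed.

Lemma growth_sum (I : Type) (r : seq I) (F : I -> coefs d Y) :
  (forall i, growth (F i)) -> growth (fun n => \sum_(i <- r) F i n).
Proof.
move=> h; elim: r => [|i r IH].
  by exists 0 => // n; rewrite big_nil ynorm0// mul0r.
have := growthD (h i) IH; congr growth; apply/funext => n.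
by rewrite big_cons.
Qed.

Definition rpow mu n : R := \prod_i mu i ^+ n i.
Definition rpoint mu : 'I_d -> R[i] := fun i => (mu i)%:C%C.
(** The homogeneous part of degree [k] at a point with real coordinates; [ev] is the limit of its
    partial sums over k. *)
Definition hom mu f k : Y := deg_sum k (fun n => (rpow mu n)%:C%C *: f n).

Lemma mpow_rpoint mu n : mpow (rpoint mu) n = (rpow mu n)%:C%C.
Proof. by rewrite /rpow rmorph_prod; apply: eq_bigr => i _; rewrite rmorphXn. Qed.

Lemma rpow_incr mu j n : rpow mu (incr j n) = mu j * rpow mu n.
Proof. by apply: (@prod_incr _ _ (fun i k => mu i ^+ k)); rewrite exprS. Qed.

Lemma rpow_scale t mu n : rpow (fun i => t * mu i) n = t ^+ mdeg n * rpow mu n.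
Proof.
rewrite /rpow -prodrXr -big_split/=; apply: eq_bigr => i _.
by rewrite exprMn.
Qed.

Lemma rpow_ge0 mu n : (forall i, 0 <= mu i) -> 0 <= rpow mu n.
Proof. by move=> h; apply: prodr_ge0 => i _; rewrite exprn_ge0. Qed.

Lemma rpow_le mu n r : (forall i, 0 <= mu i <= r) -> rpow mu n <= r ^+ mdeg n.
Proof.
move=> h; rewrite /rpow -prodrXr; apply: ler_prod => i _.
have /andP[a b] := h i; rewrite exprn_ge0//=.
by apply: lerXn2r => //; rewrite nnegrE// (le_trans a).
Qed.

Lemma hom_Mmul mu j f k : hom mu (Mmul j f) k.+1 = (mu j)%:C%C *: hom mu f k.
Proof.
rewrite /hom (deg_sum_incr _ (j := j)); last first.
  by move=> n nj; rewrite /Mmul nj ltnn scaler0.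
rewrite !deg_sumE scaler_sumr; apply: eq_bigr => n _.
rewrite rpow_incr rmorphM -scalerA /Mmul incr_gt0.
by congr (_ *: (_ *: f _)); rewrite -[RHS](incrK j).
Qed.

Lemma hom_Mmul0 mu j f : hom mu (Mmul j f) 0 = 0.
Proof. by rewrite /hom deg_sum0 /Mmul ffunE ltnn scaler0. Qed.

Lemma homD mu f g k : hom mu (fun n => f n + g n) k = hom mu f k + hom mu g k.
Proof. by rewrite /hom -deg_sumD; congr deg_sum; apply/funext => n; rewrite scalerDr. Qed.

Lemma homN mu f k : hom mu (fun n => - f n) k = - hom mu f k.
Proof. by rewrite /hom !deg_sumE -sumrN; apply: eq_bigr => n _; rewrite scalerN. Qed.

Lemma hom_sum mu (I : Type) (r : seq I) (F : I -> coefs d Y) k :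
  hom mu (fun n => \sum_(i <- r) F i n) k = \sum_(i <- r) hom mu (F i) k.
Proof.
rewrite /hom deg_sumE; under [RHS]eq_bigr do rewrite deg_sumE.
by rewrite exchange_big; apply: eq_bigr => n _; rewrite scaler_sumr.
Qed.

(* Small enough for the crude bounds on the number of multi-indices of degree
   [k] and on the coefficients to leave a geometric factor [2^-k]. *)
Definition rho : R := (2 * 2 ^+ d * d.+1%:R)^-1.

Lemma rho_gt0 : 0 < rho.
Proof. by rewrite invr_gt0 !mulr_gt0// exprn_gt0. Qed.

(** There are at most (k + 1)^d <= 2^(dk) multi-indices of degree k, each contributing at most A
    (rho (d + 1))^k, and rho (d + 1) 2^d = 1/2. *)
Lemma hom_le f : growth f -> exists2 A : R, 0 <= A &
  forall mu, (forall i, 0 <= mu i <= rho) -> forall k, N (hom mu f k) <= A * 2^-1 ^+ k.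
Proof.
move=> [A A0 hA]; exists A => // mu hmu k; rewrite /hom deg_sumE.
apply: le_trans (ynorm_sum hilb _ _ _) _.
apply: (@le_trans _ _ (\sum_(n <- mis d k) A * (rho * d.+1%:R) ^+ k)).
  rewrite big_seq [leRHS]big_seq; apply: ler_sum => n.
  rewrite mem_mis => /eqP <-.
  have p0 : 0 <= rpow mu n by apply: rpow_ge0 => i; case/andP: (hmu i).
  rewrite ynormZ// ger0_norm// exprMn mulrCA.
  by apply: ler_pM; rewrite ?ynorm_ge0//; exact: rpow_le.
rewrite big_const_seq count_predT iter_addr_0 -[leLHS]mulr_natr -mulrA ler_wpM2l//.
apply: (@le_trans _ _ ((rho * d.+1%:R) ^+ k * (2 ^+ d) ^+ k)).
  rewrite ler_wpM2l ?exprn_ge0 ?mulr_ge0 ?(ltW rho_gt0)//.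
  rewrite -!natrX ler_nat; apply: leq_trans (size_mis d k) _.
  by rewrite -expnM (mulnC d) expnM; apply: leq_expl; exact: ltn_expl.
rewrite -exprMn; have -> : rho * d.+1%:R * 2 ^+ d = 2^-1 => [|//].
by rewrite /rho; field; rewrite nat1r expf_neq0 pnatr_eq0.
Qed.

(** As rho <= 1, each mu_i^2 <= mu_i <= rho, and d rho < 1. *)
Lemma ball_rpoint mu : (forall i, 0 <= mu i <= rho) -> ball_d (rpoint mu).
Proof.
move=> hmu; rewrite /ball_d.
have -> : \sum_i `|rpoint mu i| ^+ 2 = (\sum_i mu i ^+ 2)%:C%C.
  rewrite rmorph_sum; apply: eq_bigr => i _.
  by have /andP[h _] := hmu i; rewrite ger0_norm ?rmorphXn// ler0c.
rewrite -(rmorph1 (real_complex R)) ltcR.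
apply: (@le_lt_trans _ _ (\sum_(i < d) rho)).
  apply: ler_sum => i _; have /andP[a b] := hmu i; apply: le_trans b.
  rewrite expr2 ler_piMl//; apply: le_trans (_ : rho <= _); first by case/andP: (hmu i).
  rewrite invf_le1 ?mulr_gt0 ?exprn_gt0//.
  by rewrite -natrX -!natrM ler1n !muln_gt0 expn_gt0.
rewrite sumr_const card_ord -mulr_natr /rho mulrC ltr_pdivrMr ?mulr_gt0 ?exprn_gt0//.
by rewrite mul1r -natrX -!natrM ltr_nat leq_pmull// muln_gt0 expn_gt0.
Qed.

(** [ev] chooses a limit with default 0, so a limit has to be exhibited first; the geometric bound
    on the homogeneous parts supplies it. *)
Lemma ev_cvg f mu : growth f -> (forall i, 0 <= mu i <= rho) ->
  ycvg ip (fun K => \sum_(k < K) hom mu f k) (ev ip f (rpoint mu)).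
Proof.
move=> /hom_le[A A0 hA] hmu.
have [l hl] := ycvg_geometric hilb A0 (hA mu hmu).
have -> : (fun K => \sum_(k < K) hom mu f k) = fun K => \sum_(k < K)
    deg_sum k (fun n => mpow (rpoint mu) n *: f n).
  apply/funext => K; apply: eq_bigr => k _; rewrite /hom; congr deg_sum.
  by apply/funext => n; rewrite mpow_rpoint.
rewrite /ev; apply: (@xgetPex _ 0 (fun l => ycvg ip _ l)); exists l.
have := hl; congr ycvg.
apply/funext => K; apply: eq_bigr => k _; rewrite /hom; congr deg_sum.
by apply/funext => n; rewrite mpow_rpoint.
Qed.

(** Two reductions to one variable: along rays every homogeneous part vanishes, and then the
    Kronecker substitution separates the monomials of a given degree. *)
Lemma coef_eq0 g : growth g ->
  (forall mu, (forall i, 0 < mu i <= rho) ->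
     ycvg ip (fun K => \sum_(k < K) hom mu g k) 0) ->
  forall n, g n = 0.
Proof.
move=> gg hg.
(* On the ray t mu the series is a power series in t with coefficients [hom mu g k]. *)
have hom0 mu : (forall i, 0 < mu i <= rho) -> forall k, hom mu g k = 0.
  move=> hmu; have [A A0 hA] := hom_le gg.
  apply: (@power_series_eq0 _ _ _ hilb _ A 1) => // [k|t /andP[t0 t1]].
    have hmu' i : 0 <= mu i <= rho by have /andP[/ltW -> ->] := hmu i.
    apply: le_trans (hA mu hmu' k) _; rewrite ler_piMr// exprn_ile1 ?invr_ge0//.
    by rewrite invf_le1// ler1n.
  have ht i : 0 < t * mu i <= rho.
    have /andP[m0 m1] := hmu i; rewrite mulr_gt0//=.
    by apply: le_trans m1; rewrite ler_piMl ?ltW.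
  have := hg _ ht; congr ycvg; apply/funext => K; apply: eq_bigr => k _.
  rewrite /hom !deg_sumE scaler_sumr big_seq [RHS]big_seq; apply: eq_bigr => n.
  by rewrite mem_mis => /eqP <-; rewrite rpow_scale rmorphM scalerA.
(* The base k + 1 exceeds every entry of a multi-index of degree k, so [kron b] is injective on
   them. *)
move=> n; pose k := mdeg n; pose b := k.+1.
have lt_b m : m \in mis d k -> forall i, (m i < b)%N.
  by rewrite mem_mis => /eqP mk i; rewrite /b ltnS -mk /mdeg (bigD1 i)//= leq_addr.
have nk : n \in mis d k by rewrite mem_mis.
(* The coefficient of s^e after the substitution; by injectivity it has at most one summand. *)
pose u e : Y := \sum_(m <- mis d k | kron b m == e) g m.
suff u0 : forall e, u e = 0.
  rewrite -[RHS](u0 (kron b n)) /u big_seq_cond (eq_bigl (pred1 n)).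
    by rewrite -big_filter filter_pred1_uniq ?mis_uniq// big_seq1.
  move=> m /=; apply/andP/eqP => [[mk /eqP h]|->]; last by rewrite nk eqxx.
  exact: (kron_inj (lt_b _ mk) (lt_b _ nk)).
pose A := \sum_(m <- mis d k) N (g m).
apply: (@power_series_eq0 _ _ _ hilb _ A rho rho_gt0) => [e|s /andP[s0 s1]].
  apply: le_trans (ynorm_sum hilb _ _ _) _; rewrite /A big_mkcond/=.
  by apply: ler_sum => m _; case: ifP => // _; exact: ynorm_ge0.
have s01 : s <= 1.
  apply/ltW/(lt_le_trans s1); rewrite invf_le1 ?mulr_gt0 ?exprn_gt0//.
  by rewrite -natrX -!natrM ler1n !muln_gt0 expn_gt0.
pose mu (i : 'I_d) := s ^+ (b ^ i).
have hmu i : 0 < mu i <= rho.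
  rewrite /mu exprn_gt0//=; apply: le_trans (ltW s1).
  by rewrite -[leRHS]expr1 ler_wiXn2l ?(ltW s0)// expn_gt0.
have rpowE m : rpow mu m = s ^+ kron b m.
  rewrite /rpow /kron -prodrXr; apply: eq_bigr => i _.
  by rewrite /mu -exprM mulnC.
have h0 := hom0 mu hmu k.
(* Beyond every exponent that occurs, so from K0 on the partial sums equal the full homogeneous
   part, which is 0. *)
pose K0 := (\sum_(m <- mis d k) kron b m).+1.
apply: (@ycvg_near _ _ _ (fun=> 0)); last exact: ycvg_cst.
exists K0 => // K /= hK.
rewrite -[LHS]h0 /hom deg_sumE.
under [RHS]eq_bigr do rewrite /u scaler_sumr.
rewrite (exchange_big_dep xpredT)//= big_seq [RHS]big_seq.
apply: eq_bigr => m mk; rewrite rpowE.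
have mK : (kron b m < K)%N.
  apply: leq_trans hK; rewrite ltnS (bigD1_seq m) ?mis_uniq//=.
  exact: leq_addr.
by rewrite (big_pred1 (Ordinal mK)).
Qed.

End Growth.

(** * From the two hypotheses to the coefficients of T_j f *)

Section BackwardShift.
Variables (R : realType) (d : nat) (Y : lmodType R[i]) (ip : Y -> Y -> R[i]).
Hypothesis hilb : is_hilbert ip.
Notation N := (ynorm ip).
Notation q := (ynorm2 ip).
Implicit Types (f g : coefs d Y) (n : mi d) (mu : 'I_d -> R).

Lemma hom0 mu f : hom mu f 0 = f (mi0 d).
Proof.
rewrite /hom deg_sum0 /rpow big1 ?rmorph1 ?scale1r// => i _.
by rewrite ffunE.
Qed.

Lemma ev_origin f : growth ip f -> ev ip f (@origin R d) = f (mi0 d).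
Proof.
move=> gf; have -> : @origin R d = rpoint (fun=> 0).
  by apply/funext => i; rewrite /rpoint rmorph0.
have h := ev_cvg hilb (mu := fun=> 0) gf (fun=> _).
apply: (ycvg_unique hilb (h _)) => [i|]; first by rewrite lexx ltW ?rho_gt0.
apply/ycvg_shift; have := ycvg_cst hilb (f (mi0 d)); congr ycvg.
apply/funext => K; rewrite big_ord_recl hom0 big1 ?addr0// => k _.
rewrite /hom deg_sumE big1_seq// => n; rewrite mem_mis => /andP[_ /eqP nk].
(* Writing the origin as 0 times a point lets homogeneity produce the factor 0^|n| with |n| > 0. *)
have -> : (fun=> 0) = (fun i : 'I_d => 0 * 0) :> ('I_d -> R).
  by apply/funext => i; rewrite mul0r.
by rewrite rpow_scale nk expr0n mul0r rmorph0 scale0r.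
Qed.

Lemma Mmul_incr j f n : Mmul j f (incr j n) = f n.
Proof. by rewrite /Mmul incr_gt0; congr f; rewrite -[RHS](incrK j). Qed.

(** Moving every term to one side gives a power series [g] that sums to 0 at small positive points,
    so all its coefficients vanish. *)
Lemma coef_shift_eq f (h : 'I_d -> coefs d Y) : growth ip f ->
  (forall j, growth ip (h j)) ->
  (forall lam, ball_d lam -> ev ip f lam - ev ip f (@origin R d) =
     \sum_(j < d) lam j *: ev ip (h j) lam) ->
  forall n, n != mi0 d -> f n = \sum_j Mmul j (h j) n.
Proof.
move=> gf gh hev.
pose c0 : coefs d Y := fun n => if n == mi0 d then f (mi0 d) else 0.
pose s : coefs d Y := fun n => \sum_j Mmul j (h j) n.
pose g : coefs d Y := fun n => f n + - (c0 n + s n).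
have gc0 : growth ip c0.
  exists (N (f (mi0 d))) => [|n]; first exact: ynorm_ge0.
  rewrite /c0; case: eqP => [->|_]; first by rewrite mdeg0 expr0 mulr1.
  by rewrite ynorm0// mulr_ge0 ?ynorm_ge0// exprn_ge0.
have gg : growth ip g.
  apply: growthD => //; apply: growthN => //; apply: growthD => //.
  by apply: growth_sum => // j; exact: growth_Mmul.
suff g0 : forall n, g n = 0.
  move=> n n0; apply/eqP; rewrite -subr_eq0; apply/eqP.
  by have := g0 n; rewrite /g /c0 (negPf n0) add0r.
apply: (coef_eq0 hilb gg) => mu hmu.
have hmu' i : 0 <= mu i <= rho R d by have /andP[/ltW -> ->] := hmu i.
have cf := ev_cvg hilb gf hmu'.
have cc0 : ycvg ip (fun K => \sum_(k < K) hom mu c0 k) (f (mi0 d)).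
  apply/ycvg_shift; have := ycvg_cst hilb (f (mi0 d)); congr ycvg.
  apply/funext => K; rewrite big_ord_recl hom0 /c0 eqxx big1 ?addr0// => k _.
  rewrite /hom (deg_sum_single (n := mi0 d)) ?mdeg0// => n /negPf ->.
  by rewrite scaler0.
(* Multiplication by lambda_j raises degrees by one, so the partial sums are compared after an index
   shift. *)
have cM j : ycvg ip (fun K => \sum_(k < K) hom mu (Mmul j (h j)) k)
    ((mu j)%:C%C *: ev ip (h j) (rpoint mu)).
  apply/ycvg_shift; have := ycvgZ hilb (mu j) (ev_cvg hilb (gh j) hmu').
  congr ycvg; apply/funext => K; rewrite big_ord_recl hom_Mmul0 add0r scaler_sumr.
  by apply: eq_bigr => k _; rewrite hom_Mmul.
have cs := ycvg_sum hilb (index_enum 'I_d) cM.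
have := ycvgD hilb cf (ycvgZ hilb (-1) (ycvgD hilb cc0 cs)).
have -> : ev ip f (rpoint mu) + (-1)%:C%C *: (f (mi0 d) +
    \sum_j (mu j)%:C%C *: ev ip (h j) (rpoint mu)) = 0.
  rewrite -(hev _ (ball_rpoint hmu')) ev_origin// [f _ + _]addrC subrK.
  by rewrite rmorphN rmorph1 scaleN1r subrr.
congr ycvg; apply/funext => K.
rewrite exchange_big/= -big_split/= scaler_sumr -big_split/=.
apply: eq_bigr => k _; rewrite /g homD homN homD -hom_sum.
by rewrite rmorphN rmorph1 scaleN1r.
Qed.

(** Since W_j c_j = w wherever c_j is nonzero, and v_j = 0 elsewhere, the cross terms add up to -2 w
    <sum_j v_j, y> = -2 w |y|^2 and the quadratic ones to w |y|^2 sum_j c_j = w |y|^2. *)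
Lemma shift_term_identity (W : 'I_d -> R) (v : 'I_d -> Y)
    (w : R) (y : Y) (c : 'I_d -> R) :
  y = \sum_j v j -> \sum_j c j = 1 -> (forall j, c j = 0 -> v j = 0) ->
  (forall j, W j * c j = if c j == 0 then 0 else w) ->
  \sum_j W j * q (v j - (c j)%:C%C *: y) + w * q y = \sum_j W j * q (v j).
Proof.
move=> yv c1 v0 Wc.
have -> : \sum_j W j * q (v j - (c j)%:C%C *: y) =
    \sum_j (W j * q (v j) - 2 * w * rip ip (v j) y + w * q y * c j).
  apply: eq_bigr => j _; rewrite ynorm2_lin//.
  have e1 : W j * c j * rip ip (v j) y = w * rip ip (v j) y.
    rewrite Wc; case: eqP => // /v0 ->; by rewrite /rip ip0l// !mulr0.
  have e2 : W j * c j * c j = w * c j.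
    by rewrite Wc; case: eqP => [->|//]; rewrite !mulr0.
  transitivity (W j * q (v j) - 2 * (W j * c j * rip ip (v j) y) + W j * c j * c j * q y).
    by ring.
  by rewrite e1 e2; ring.
rewrite big_split sumrB/= -!mulr_sumr c1 -rip_suml// -yv -ynorm2E.
ring.
Qed.

(** With [a] the weighted squared deviations, a + b sums to sum_j ||h_j||^2 and b to ||f||^2 -
    |f_0|^2. The norm inequality then forces the nonnegative [a] to vanish. *)
Lemma backward_shift_coef f (h : 'I_d -> coefs d Y) : inH ip f ->
  (forall n, n != mi0 d -> f n = \sum_j Mmul j (h j) n) ->
  (\sum_j Hnorm2 ip (h j) <= Hnorm2 ip f - (q (f (mi0 d)))%:E)%E ->
  forall j n, h j n = ((n j).+1%:R / (mdeg n).+1%:R)%:C%C *: f (incr j n).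
Proof.
move=> fH fh hle.
(* The weight w(n - e_j), set to 0 where n - e_j is not a multi-index. *)
pose W (j : 'I_d) (n : mi d) := if (0 < n j)%N then weight R (decr j n) else 0.
pose c (j : 'I_d) (n : mi d) : R := (n j)%:R / (mdeg n)%:R.
have W0 j n : 0 <= W j n by rewrite /W; case: ifP => // _; rewrite ltW ?weight_gt0.
pose a n := \sum_j W j n * q (Mmul j (h j) n - (c j n)%:C%C *: f n).
pose b n := if n == mi0 d then 0 else weight R n * q (f n).
have a0 n : 0 <= a n by apply: sumr_ge0 => j _; rewrite mulr_ge0 ?ynorm2_ge0.
have b0 n : 0 <= b n.
  by rewrite /b; case: ifP => // _; rewrite mulr_ge0 ?ynorm2_ge0 ?ltW ?weight_gt0.
have ab n : a n + b n = \sum_j W j n * q (Mmul j (h j) n).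
  rewrite /a /b; case: eqP => [->|/eqP n0].
    by rewrite addr0; apply: eq_bigr => j _; rewrite /W ffunE !mul0r.
  have dn : (mdeg n)%:R != 0 :> R.
    by rewrite pnatr_eq0; apply: contraNneq n0 => /mdeg_eq0 ->.
  apply: shift_term_identity => //; first exact: fh.
  - by rewrite /c -mulr_suml -natr_sum divff.
  - move=> j /eqP; rewrite /c mulf_eq0 invr_eq0 (negPf dn) orbF pnatr_eq0 => /eqP nj.
    by rewrite /Mmul nj.
  - move=> j; rewrite /c mulf_eq0 invr_eq0 (negPf dn) orbF pnatr_eq0 /W.
    case: posnP => [->|nj]; first by rewrite mul0r.
    rewrite -[in RHS](decrK nj) weight_incr -(mdeg_incr j) decrK//.
    by rewrite ffunE eqxx prednK// mulrC.
have E1 : (\esum_(n in [set: mi d]) (a n)%:E + \esum_(n in [set: mi d]) (b n)%:E =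
    \sum_j Hnorm2 ip (h j))%E.
  rewrite -esumD; [|by move=> n _; rewrite lee_fin..].
  transitivity (\esum_(n in [set: mi d]) \sum_j (W j n * q (Mmul j (h j) n))%:E)%E.
    by apply: eq_esum => n _; rewrite -EFinD ab sumEFin.
  rewrite esum_sum; last by move=> n j _ _; rewrite lee_fin mulr_ge0 ?ynorm2_ge0.
  apply: eq_bigr => j _; rewrite /Hnorm2.
  (* Only indices with n_j > 0 contribute, and n -> n + e_j enumerates them. *)
  rewrite [LHS](@esumID _ _ [set n : mi d | (0 < n j)%N]); last first.
    by move=> n _; rewrite lee_fin mulr_ge0 ?ynorm2_ge0.
  rewrite [X in (_ + X)%E]esum1 ?adde0; last first.
    by move=> n [_ /= /negP/negPf nj]; rewrite /W nj mul0r.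
  rewrite setTI (@reindex_esum _ _ _ setT _ (incr j)); last first.
    split => [n _|n m _ _|n /= nj] /=; first exact: incr_gt0.
      exact: (can_inj (@incrK _ j)).
    by exists (decr j n) => //; rewrite decrK.
  by apply: eq_esum => n _; rewrite /W incr_gt0 incrK Mmul_incr.
(* As w(0) = 1, the term missing from [b] is exactly |f_0|^2. *)
have E2 : (Hnorm2 ip f = (q (f (mi0 d)))%:E + \esum_(n in [set: mi d]) (b n)%:E)%E.
  rewrite -[X in (X + _)%E](@esum_set1 _ _ (mi0 d) (fun=> (q (f (mi0 d)))%:E)); last first.
    by rewrite lee_fin ynorm2_ge0.
  rewrite esum_mkcond -esumD;
    [|by move=> n _; rewrite ?lee_fin//; case: ifP; rewrite ?lee_fin ?ynorm2_ge0..].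
  apply: eq_esum => n _; have -> : (n \in [set mi0 d]) = (n == mi0 d).
    by apply/idP/eqP; rewrite inE.
  rewrite /b; case: eqP => [->|_]; last by rewrite add0e.
  by rewrite adde0 /weight mdeg0 /mfact big1 ?divr1 ?mul1r// => i _; rewrite ffunE.
(* Finiteness permits cancelling the sum of [b] in the extended reals. *)
have bfin : (\esum_(n in [set: mi d]) (b n)%:E)%E \is a fin_num.
  rewrite ge0_fin_numE; last by apply: esum_ge0 => n _; rewrite lee_fin.
  by apply: le_lt_trans fH; rewrite E2 leeDr// lee_fin ynorm2_ge0.
have aS : (\esum_(n in [set: mi d]) (a n)%:E <= 0)%E.
  move: hle; rewrite -E1 E2 addeAC subee// add0e.
  by rewrite -[leRHS]add0e leeD2rE.
have aE n : a n = 0.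
  apply/eqP; rewrite eq_le a0 andbT -lee_fin; apply: le_trans aS.
  by apply: (@esum_ge_term _ _ (fun n => (a n)%:E)) => m; rewrite lee_fin.
(* At n + e_j the j-th square carries the weight w(n) > 0, so it vanishes. *)
move=> j n; have /eqP := aE (incr j n); rewrite /a psumr_eq0; last first.
  by move=> i _; rewrite mulr_ge0 ?ynorm2_ge0.
move=> /allP/(_ j (mem_index_enum _)) /=.
rewrite /W incr_gt0 incrK mulf_eq0 gt_eqF ?weight_gt0//= Mmul_incr => /eqP.
move=> /(ynorm2_eq0 hilb)/eqP; rewrite subr_eq0 => /eqP ->.
by rewrite /c mdeg_incr ffunE eqxx.
Qed.

End BackwardShift.

(** * The adjoint of multiplication by lambda_j, computed on coefficients *)

Lemma limn_series_shift (R : realType) (u v : nat -> R) :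
  u 0%N = 0 -> (forall k, u k.+1 = v k) -> limn (series u) = limn (series v).
Proof.
(* Both series have the same set of limits, so the chosen values agree whether or not they
   converge. *)
move=> u0 uv; rewrite /lim /lim_in; congr get; apply/funext => l.
rewrite -[LHS](cvg_shiftS (series u)).
suff -> : [sequence series u n.+1]_n = series v by [].
by apply/funext => k; rewrite /series/= big_nat_recl// u0 add0r; apply: eq_bigr.
Qed.

Lemma limn_series_single (R : realType) (u : nat -> R) m :
  (forall k, k != m -> u k = 0) -> limn (series u) = u m.
Proof.
move=> um; apply: (@lim_near_cst R^o); first exact: norm_hausdorff.
exists m.+1 => // k /= mk; rewrite /series/= big_mkord (bigD1 (Ordinal mk))//=.
by rewrite big1 ?addr0// => i im; apply: um; apply: contraNN im => /eqP im; apply/eqP/val_inj.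
Qed.

Section Adjoint.
Variables (R : realType) (d : nat) (Y : lmodType R[i]) (ip : Y -> Y -> R[i]).
Hypothesis hilb : is_hilbert ip.
Implicit Types (f g h : coefs d Y) (n : mi d).

Lemma weightCE n : weightC R n = (weight R n)%:C%C.
Proof. by rewrite /weightC /weight fmorph_div !rmorph_nat. Qed.

(** The degree k + 1 part of <M_j g, f> is the degree k part of <g, h>, because w(n + e_j) = w(n)
    (n_j + 1) / (|n| + 1); the degree 0 part is 0. *)
Lemma Hip_Mmul j f h g :
  (forall n, h n = ((n j).+1%:R / (mdeg n).+1%:R)%:C%C *: f (incr j n)) ->
  Hip ip (Mmul j g) f = Hip ip g h.
Proof.
move=> hE.
have t0 : Hip_term ip (Mmul j g) f 0 = 0.
  by rewrite /Hip_term deg_sum0 /Mmul ffunE ltnn ip0l// mulr0.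
have tS k : Hip_term ip (Mmul j g) f k.+1 = Hip_term ip g h k.
  rewrite /Hip_term (deg_sum_incr _ (j := j)); last first.
    by move=> n nj; rewrite /Mmul nj ltnn ip0l// mulr0.
  congr deg_sum; apply/funext => n; rewrite Mmul_incr hE ipZr//.
  rewrite (conjc_real _ : Num.conj _%:C%C = _).
  by rewrite !weightCE weight_incr rmorphM -mulrA mulrCA.
by rewrite /Hip; congr Complex; apply: limn_series_shift => [|k]; rewrite ?t0 ?tS.
Qed.

(** The function y lambda^n, a test element that isolates one coefficient in [Hip]. *)
Definition monomial n (y : Y) : coefs d Y := fun m => if m == n then y else 0.

Lemma inH_monomial n y : inH ip (monomial n y).
Proof.
rewrite /inH /Hnorm2.
have -> : (fun m => (weight R m * ynorm2 ip (monomial n y m))%:E) =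
    (fun m => if m \in [set n] then (weight R n * ynorm2 ip y)%:E else 0%E).
  apply/funext => m; have -> : (m \in [set n]) = (m == n).
    by apply/idP/eqP; rewrite inE.
  by rewrite /monomial; case: eqP => [->//|_]; rewrite ynorm20// mulr0.
rewrite -esum_mkcond esum_set1 ?ltry//.
by rewrite lee_fin mulr_ge0 ?ynorm2_ge0// ltW ?weight_gt0.
Qed.

Lemma Hip_monomial n y h : Hip ip (monomial n y) h = weightC R n * ip y (h n).
Proof.
have tE k : Hip_term ip (monomial n y) h k =
    if k == mdeg n then weightC R n * ip y (h n) else 0.
  rewrite /Hip_term (deg_sum_single (n := n)) /monomial ?eqxx// => m /negPf ->.
  by rewrite ip0l// mulr0.
rewrite /Hip (limn_series_single (m := mdeg n)); last first.
  by move=> k /negPf kn; rewrite tE kn.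
rewrite (limn_series_single (m := mdeg n)); last first.
  by move=> k /negPf kn; rewrite tE kn.
by rewrite tE eqxx; case: (_ * _).
Qed.

Lemma MadjE j f h : inH ip h ->
  (forall n, h n = ((n j).+1%:R / (mdeg n).+1%:R)%:C%C *: f (incr j n)) ->
  Madj ip j f = h.
Proof.
move=> hH hE; apply: xget_unique.
  by split => // g _; exact: Hip_Mmul.
(* Uniqueness of the adjoint image: test against the monomial of index n with coefficient h'_n -
   h_n. *)
move=> h' [_ adj]; apply/funext => n; apply/eqP; rewrite -subr_eq0; apply/eqP.
apply: (ip_definite hilb); rewrite ipBr//; apply/eqP; rewrite subr_eq0; apply/eqP.
have w0 : weightC R n != 0.
  by rewrite weightCE (fmorph_eq0 (real_complex R)) gt_eqF// weight_gt0.
apply: (mulfI w0); rewrite -!Hip_monomial.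
rewrite -adj; last exact: inH_monomial.
exact: Hip_Mmul.
Qed.

End Adjoint.

Theorem theorem3p22 (R : realType) (d : nat) (Y : lmodType R[i])
  (ip : Y -> Y -> R[i]) (M : set (coefs d Y)) (T : 'I_d -> coefs d Y -> coefs d Y) :
  is_hilbert ip ->
  isometric_subspace ip M ->
  (forall j, bounded_op_on ip M (T j)) ->
  (forall f, M f -> forall lam, ball_d lam ->
     ev ip f lam - ev ip f (@origin R d) = \sum_(j < d) lam j *: ev ip (T j f) lam) ->
  (forall f, M f ->
     (\sum_(j < d) Hnorm2 ip (T j f) <= Hnorm2 ip f - (ynorm2 ip (ev ip f (@origin R d)))%:E)%E) ->
  forall j : 'I_d, forall f, M f ->
    M (Madj ip j f) /\ T j f = Madj ip j f.
Proof.
move=> hilb [MH _ _ _] Tb hev hnorm j f Mf.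
have TM i : M (T i f) by case: (Tb i) => h _ _; exact: h.
have gf := growth_inH hilb (MH _ Mf).
have gT i := growth_inH hilb (MH _ (TM i)).
have hle := hnorm f Mf; rewrite ev_origin// in hle.
have fT := coef_shift_eq hilb gf gT (hev f Mf).
have TE := backward_shift_coef hilb (MH _ Mf) fT hle.
(* T_j f has the coefficients of the adjoint image and lies in [M], which gives both claims. *)
have -> : Madj ip j f = T j f by apply: MadjE => //; exact: MH.
by split.
Qed.
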